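(* The fully explicit scheme ($\sharp=n$) described in the context is well-balanced on any two-dimensional unstructured mesh, in the following sense. Suppose there is a constant $H$ such that the initial discrete data satisfy $h_j^0+z_j=H$ and $\mathbf{u}_j^0=\mathbf{0}$ for all $j$. Then for every $n\ge 0$ the discrete solution satisfies $h_j^n+z_j=H$ and $\mathbf{u}_j^n=\mathbf{0}$ for all $j$.
   Context: Scheme for the shallow water equations $\partial_t h+\nabla\cdot(h\mathbf{u})=0$, $\partial_t(h\mathbf{u})+\nabla\cdot(h\mathbf{u}\otimes\mathbf{u})+\nabla\frac{gh^2}{2}=-gh\nabla z$ in two space dimensions, with $g>0$ constant and $z$ a given topography. Mesh. The bounded domain $\Omega\subset\mathbb{R}^2$ is covered by $N$ polygonal cells $(\Omega_j)_{1\le j\le N}$. Each face of $\Omega_j$ is either $\Gamma_{jk}=\overline{\Omega_j}\cap\overline{\Omega_k}$ for a single $k\in\{1,\dots,N\}$, or lies in $\partial\Omega$ and is denoted $\Gamma_{jk}$ with a single ghost index $k>N$. $\mathcal{N}(j)$ is the set of $k$ such that $\Gamma_{jk}$ is a face of $\Omega_j$, $\mathbf{n}_{jk}$ is the unit normal to $\Gamma_{jk}$ pointing out of $\Omega_j$, and $\sigma_{jk}=|\Gamma_{jk}|/|\Omega_j|$ (length of the face over area of the cell). Each ghost cell $k>N$ is assigned an interior cell $m(k)\in\{1,\dots,N\}$ and all its values ($z$, and $h,\mathbf{u},\Pi$ at all time levels, including the intermediate one) are copies of those of cell $m(k)$ (this covers Neumann and periodic conditions). Unknowns. At time level $n$ the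 discrete state is $(h_j^n,\mathbf{u}_j^n)$ with $h_j^n>0$, $\mathbf{u}_j^n\in\mathbb{R}^2$, and $z_j\in\mathbb{R}$ is the given discrete topography. Set $\tau_j^n=1/h_j^n$, $\Pi_j^n=g(h_j^n)^2/2$, $c_j^n=\sqrt{g h_j^n}$. Let $\Delta t>0$ be the time step, $a_{jk}\ge\max(h_j^nc_j^n,h_k^nc_k^n)$, $\theta_{jk}\in[0,1]$ (the values $a_{jk},\theta_{jk}$ may depend on $n$; the typical choice is $\theta_{jk}=\min(|u_{jk}^n|/\max(c_j^n,c_k^n),1)$, and $\theta_{jk}=1$ is the uncorrected scheme), with $a_{jk}=a_{kj}$, $\theta_{jk}=\theta_{kj}$. Fluxes. Put $\{gh\Delta z\}_{jk}^n=g\frac{h_j^n+h_k^n}{2}(z_k-z_j)$ and $$u_{jk}^{n}=\tfrac12\mathbf{n}_{jk}^T(\mathbf{u}_j^n+\mathbf{u}_k^n)-\tfrac{1}{2a_{jk}}(\Pi_k^n-\Pi_j^n)-\tfrac{1}{2a_{jk}}\{gh\Delta z\}_{jk}^n,$$ $$\Pi_{jk}^{n,\theta}=\tfrac12(\Pi_j^n+\Pi_k^n)-\tfrac{a_{jk}\theta_{jk}}{2}\mathbf{n}_{jk}^T(\mathbf{u}_k^n-\mathbf{u}_j^n)+\tfrac12\{gh\Delta z\}_{jk}^n.$$ Acoustic step. $$\tau_j^{n+1-}=\tau_j^n+\tau_j^n\Delta t\sum_{k\in\mathcal{N}(j)}\sigma_{jk}u_{jk}^n,\quad \mathbf{u}_j^{n+1-}=\mathbf{u}_j^n-\tau_j^n\Delta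 t\sum_{k\in\mathcal{N}(j)}\sigma_{jk}\Pi_{jk}^{n,\theta}\mathbf{n}_{jk},\quad \Pi_j^{n+1-}=\Pi_j^n-\tau_j^n\Delta t\sum_{k\in\mathcal{N}(j)}\sigma_{jk}a_{jk}^2u_{jk}^n,$$ and $h_j^{n+1-}=1/\tau_j^{n+1-}$, $(h\mathbf{u})_j^{n+1-}=h_j^{n+1-}\mathbf{u}_j^{n+1-}$. Transport step. For $\varphi\in\{h,h\mathbf{u}\}$, $$\varphi_j^{n+1}=\varphi_j^{n+1-}-\Delta t\sum_{k\in\mathcal{N}(j)}\sigma_{jk}\varphi_{jk}^{n+1-}u_{jk}^n+\Delta t\,\varphi_j^{n+1-}\sum_{k\in\mathcal{N}(j)}\sigma_{jk}u_{jk}^n,$$ where $\varphi_{jk}^{n+1-}=\varphi_j^{n+1-}$ if $u_{jk}^n\ge0$ and $\varphi_{jk}^{n+1-}=\varphi_k^{n+1-}$ if $u_{jk}^n<0$; then $\mathbf{u}_j^{n+1}=(h\mathbf{u})_j^{n+1}/h_j^{n+1}$. *)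

(* Defs.v *)
From HB Require Import structures.
From mathcomp Require Import all_boot all_order all_algebra.
From mathcomp Require Import all_classical all_reals all_analysis.
Set Implicit Arguments.
Unset Strict Implicit.
Unset Printing Implicit Defensive.
Import Order.TTheory GRing.Theory Num.Theory numFieldNormedType.Exports.
Local Open Scope classical_set_scope.
Local Open Scope ring_scope.

Notation plane R := (R * R)%type.

Section PlaneGeometry.
Context {R : realType}.

Definition dotp (x y : plane R) : R := x.1 * y.1 + x.2 * y.2.

(* The library norm on a product is the sup norm. *)
Definition enorm (x : plane R) : R := Num.sqrt (dotp x x).

Definition segm (e : plane R * plane R) : set (plane R) :=
  [set x | exists2 t : R, 0 <= t <= 1 & x = e.1 + t *: (e.2 - e.1)].

Definition area (A : set (plane R)) : R :=
  fine ((@lebesgue_measure R \x @lebesgue_measure R)%E A).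

Definition frontier (A : set (plane R)) : set (plane R) := closure A `\` A°.

(* The segments [e k], k \in F, are the edges of a simple closed polygonal
   curve, each one oriented from [(e k).1] to [(e k).2]. The curve may run
   clockwise or counterclockwise, and consecutive edges may be aligned. *)
Definition simple_closed_polygon (I : finType) (F : {set I})
    (e : I -> plane R * plane R) : Prop :=
  exists s : seq I,
    [/\ uniq s, s =i F, (2 < size s)%N,
        cycle (fun k l => (e k).2 == (e l).1) s &
        {in F &, injective (fun k => (e k).1)} /\
        (forall k l, k \in F -> l \in F -> k != l ->
           segm (e k) `&` segm (e l) `<=`
             [set (e k).1; (e k).2] `&` [set (e l).1; (e l).2])].

(* [C] is the (open) region enclosed by that curve. *)
Definition polygonal_cell (C : set (plane R)) (I : finType) (F : {set I})
    (e : I -> plane R * plane R) : Prop :=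
  [/\ simple_closed_polygon F e,
      open C, connected C, bounded_set C &
      frontier C = [set x | exists2 k, k \in F & segm (e k) x]].

Definition outward_unit_normal (C : set (plane R)) (e : plane R * plane R)
    (n : plane R) : Prop :=
  [/\ enorm n = 1, dotp n (e.2 - e.1) = 0 &
      forall s : R, 0 < s < 1 ->
        \forall t \near 0^'+, ~ closure C (e.1 + s *: (e.2 - e.1) + t *: n)].

End PlaneGeometry.

(* [inl] indexes the interior cells, [inr] the ghost cells. *)
Notation cell_index N K := ('I_N + 'I_K)%type.

Record mesh (R : realType) (N K : nat) := Mesh {
  domain : set (plane R);
  cell : 'I_N -> set (plane R);
  nbrs : 'I_N -> {set cell_index N K};
  (* end points of the face between j and k; relevant for k \in nbrs j only *)
  face : 'I_N -> cell_index N K -> plane R * plane R;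
  normal : 'I_N -> cell_index N K -> plane R;
  ghost_copy : 'I_K -> 'I_N;
  domain_open : open domain;
  domain_connected : connected domain;
  domain_bounded : bounded_set domain;
  cell_subset : forall j, cell j `<=` domain;
  cell_disjoint : forall i j, i != j -> cell i `&` cell j = set0;
  cell_cover : closure domain = [set x | exists j, closure (cell j) x];
  cell_polygonal : forall j, polygonal_cell (cell j) (nbrs j) (face j);
  face_interior : forall j k, inl k \in nbrs j ->
    segm (face j (inl k)) = closure (cell j) `&` closure (cell k);
  face_boundary : forall j k, inr k \in nbrs j ->
    segm (face j (inr k)) `<=` frontier domain;
  normal_outward : forall j k, k \in nbrs j ->
    outward_unit_normal (cell j) (face j k) (normal j k)
}.

Section Scheme.
Context {R : realType} {N K : nat} (M : mesh R N K).
Local Notation index := (cell_index N K).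

Definition sigma (j : 'I_N) (k : index) : R :=
  enorm ((face M j k).2 - (face M j k).1) / area (cell M j).

(* value on an interior or ghost cell *)
Definition ext {T : Type} (f : 'I_N -> T) (k : index) : T :=
  match k with inl i => f i | inr i => f (ghost_copy M i) end.

Section OneStep.
Context (g : R) (z : 'I_N -> R) (dt : R) (a theta : index -> index -> R).
Context (h : 'I_N -> R) (u : 'I_N -> plane R).

Definition tau (j : 'I_N) : R := 1 / h j.
Definition Pi (j : 'I_N) : R := g * h j ^+ 2 / 2.
Definition celerity (j : 'I_N) : R := Num.sqrt (g * h j).

Definition admissible_parameters : Prop :=
  forall j k, k \in nbrs M j ->
    [/\ Num.max (h j * celerity j) (ext h k * ext celerity k) <= a (inl j) k,
        0 <= theta (inl j) k <= 1,
        a (inl j) k = a k (inl j) &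
        theta (inl j) k = theta k (inl j)].

Definition ghdz (j : 'I_N) (k : index) : R :=
  g * ((h j + ext h k) / 2) * (ext z k - z j).

Definition u_face (j : 'I_N) (k : index) : R :=
  1 / 2 * dotp (normal M j k) (u j + ext u k)
  - 1 / (2 * a (inl j) k) * (ext Pi k - Pi j)
  - 1 / (2 * a (inl j) k) * ghdz j k.

Definition Pi_face (j : 'I_N) (k : index) : R :=
  1 / 2 * (Pi j + ext Pi k)
  - a (inl j) k * theta (inl j) k / 2 * dotp (normal M j k) (ext u k - u j)
  + 1 / 2 * ghdz j k.

Definition tau_acoustic (j : 'I_N) : R :=
  tau j + tau j * dt * \sum_(k in nbrs M j) sigma j k * u_face j k.

Definition u_acoustic (j : 'I_N) : plane R :=
  u j - (tau j * dt) *: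
    \sum_(k in nbrs M j) (sigma j k * Pi_face j k) *: normal M j k.

(* This value does not enter the transport step: at the next time level the
   pressure is reset to [Pi] of the new height. *)
Definition Pi_acoustic (j : 'I_N) : R :=
  Pi j - tau j * dt *
    \sum_(k in nbrs M j) sigma j k * a (inl j) k ^+ 2 * u_face j k.

Definition h_acoustic (j : 'I_N) : R := 1 / tau_acoustic j.
Definition hu_acoustic (j : 'I_N) : plane R := h_acoustic j *: u_acoustic j.

Definition upwind {V : Type} (phi : 'I_N -> V) (j : 'I_N) (k : index) : V :=
  if 0 <= u_face j k then phi j else ext phi k.

Definition transport {V : lmodType R} (phi : 'I_N -> V) (j : 'I_N) : V :=
  phi j
  - dt *: \sum_(k in nbrs M j) (sigma j k * u_face j k) *: upwind phi j k
  + (dt * \sum_(k in nbrs M j) sigma j k * u_face j k) *: phi j.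

Definition h_next (j : 'I_N) : R := transport h_acoustic j.
Definition hu_next (j : 'I_N) : plane R := transport hu_acoustic j.
Definition u_next (j : 'I_N) : plane R := (h_next j)^-1 *: hu_next j.

End OneStep.

Definition discrete_solution (g : R) (z : 'I_N -> R) (dt : nat -> R)
    (a theta : nat -> index -> index -> R)
    (h : nat -> 'I_N -> R) (u : nat -> 'I_N -> plane R) : Prop :=
  forall n,
    [/\ forall j, 0 < h n j,
        0 < dt n,
        admissible_parameters g (a n) (theta n) (h n),
        forall j, h n.+1 j = h_next g z (dt n) (a n) (h n) (u n) j &
        forall j, u n.+1 j = u_next g z (dt n) (a n) (theta n) (h n) (u n) j].

End Scheme.

(* Main.v *)
Require Import Defs.
From HB Require Import structures.
From mathcomp Require Import all_boot all_order all_algebra.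
From mathcomp Require Import all_classical all_reals all_analysis.
From mathcomp Require Import ring lra.
Import Order.TTheory GRing.Theory Num.Theory numFieldNormedType.Exports.
Local Open Scope ring_scope.

(** A lake at rest is a fixed point of one time step, and the theorem follows
    by induction on the time level.

    With zero velocities and h + z constant, the discrete source
    g (h_j + h_k) / 2 (z_k - z_j) is exactly Pi_j - Pi_k ([hydrostatic_balance]). Hence every face
    velocity vanishes ([rest_u_face]), which leaves the acoustic height
    unchanged and makes the transport step the identity; and every face
    pressure of the cell j equals Pi_j ([rest_Pi_face]). The momentum of the
    cell j then receives a multiple of the sum over its faces of length times
    outward normal, which must be shown to vanish ([cell_normals_sum0]).

    For a polygon traversed edge by edge, length times normal is the edge
    vector turned by a quarter turn, to the left or to the right, and the edge
    vectors add up to zero. The only difficulty is that the outward normals are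
    all on the same side of the directed curve. It is settled locally at each
    vertex. A segment that avoids the
    frontier of the open cell C cannot leave C ([segm_stays_inside]). By this,
    the side of an edge opposite to its outward normal is in C
    ([interior_side]). If at a vertex the normals of the two edges were on
    different sides, then on each side of the curve one edge would see C and
    the other its exterior. But one of the two sectors at the vertex is convex,
    and a short segment in it joins both edges without meeting the frontier
    ([corner]): a contradiction ([same_orientation]). *)

Section PolygonalCells.
Local Open Scope classical_set_scope.
Context {R : realType}.
Implicit Types (p q v w x y d n : plane R) (C : set (plane R)).

(** * Segments and the frontier of an open set *)

Lemma plane_eq x y : x.1 = y.1 -> x.2 = y.2 -> x = y.
Proof. by case: x y => [? ?] [? ?] /= -> ->. Qed.

Lemma segm_param_continuous (e : plane R * plane R) :
  continuous (fun t : R => e.1 + t *: (e.2 - e.1)).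
Proof.
move=> t; apply: cvgD; first exact: cvg_cst.
by apply: cvgZr_tmp => //; exact: cvg_id.
Qed.

Lemma segm_image (e : plane R * plane R) :
  segm e = (fun t : R => e.1 + t *: (e.2 - e.1)) @` `[0, 1].
Proof.
apply/seteqP; split=> x /=.
  by move=> [t t01 ->]; exists t => //; rewrite in_itv.
by move=> [t]; rewrite in_itv /= => t01 <-; exists t.
Qed.

Lemma segm_closed (e : plane R * plane R) : closed (segm e).
Proof.
apply: compact_closed; first exact: norm_hausdorff.
rewrite segm_image; apply: continuous_compact; last exact: segment_compact.
by apply: continuous_subspaceT; exact: segm_param_continuous.
Qed.

Lemma segm_connected (e : plane R * plane R) : connected (segm e).
Proof.
rewrite segm_image; apply: connected_continuous_connected; first exact: segment_connected.
by apply: continuous_subspaceT; exact: segm_param_continuous.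
Qed.

Lemma segm_start (e : plane R * plane R) : segm e e.1.
Proof. by exists 0; rewrite ?lexx ?ler01// scale0r addr0. Qed.

Lemma segm_end (e : plane R * plane R) : segm e e.2.
Proof. by exists 1; rewrite ?lexx ?ler01// scale1r addrC subrK. Qed.

(** A segment is connected, and a set that is open, and closed away from its
    frontier, cannot cut it. Membership in a cell is carried from one point to
    another by this fact alone. *)
Lemma segm_stays_inside C x y : open C -> C x ->
  segm (x, y) `<=` ~` frontier C -> C y.
Proof.
move=> oC Cx avoid.
suff E : segm (x, y) `&` C = segm (x, y).
  by have := segm_end (x, y); rewrite -E => -[].
have := @segm_connected (x, y); apply.
- by exists x; split => //; exact: (segm_start (x, y)).
- by exists C.
- exists (closure C); first exact: closed_closure.
  apply/seteqP; split=> z [sz Cz]; split=> //; first exact: subset_closure.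
  by apply: contrapT => nCz; apply: (avoid z sz); split=> //; rewrite (interior_id _).1.
Qed.

Lemma near_avoid_segm {I : finType} (P : pred I) (e : I -> plane R * plane R) p :
  (forall k, P k -> ~ segm (e k) p) ->
  \forall x \near p, forall k, P k -> ~ segm (e k) x.
Proof.
move=> out; refine (@filter_forall _ I (fun k x => P k -> ~ segm (e k) x) (nbhs p) _ _) => k.
apply: filter_imply => Pk; apply: open_nbhs_nbhs; split; last exact: out.
by apply: closed_openC; exact: segm_closed.
Qed.

Lemma convex_comb_gt0 (t a b : R) : 0 <= t <= 1 -> 0 < a -> 0 < b ->
  0 < (1 - t) * a + t * b.
Proof.
move=> /andP[t0 t1] a0 b0.
have [->|tn0] := eqVneq t 0; first by rewrite subr0 mul1r mul0r addr0.
apply: ltr_wpDl; first by rewrite mulr_ge0 ?subr_ge0 // ltW.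
by rewrite mulr_gt0 // lt_neqAle eq_sym tn0.
Qed.

Lemma ball_segm p (r : R) x y : ball p r x -> ball p r y ->
  segm (x, y) `<=` ball p r.
Proof.
move=> [/= x1 x2] [/= y1 y2] _ [t /andP[t0 t1] ->].
move: x1 x2 y1 y2; rewrite /ball /= => x1 x2 y1 y2.
have H (a b c : R) : `|a - b| < r -> `|a - c| < r -> `|a - (b + t * (c - b))| < r.
  rewrite !ltr_norml => /andP[u1 u2] /andP[v1 v2].
  have upper : 0 < (1 - t) * (r - (a - b)) + t * (r - (a - c)).
    by apply: convex_comb_gt0; rewrite ?t0//; lra.
  have lower : 0 < (1 - t) * (a - b + r) + t * (a - c + r).
    by apply: convex_comb_gt0; rewrite ?t0//; lra.
  by apply/andP; split; lra.
by split; rewrite /ball /=; exact: H.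
Qed.

Lemma near_ray (U : set (plane R)) p w : nbhs p U ->
  \forall t \near (0:R)^'+, U (p + t *: w).
Proof.
move=> Up.
have cvp : (p + t *: w) @[t --> (0:R)^'+] --> p.
  rewrite -[X in _ --> X]addr0 -[X in _ + X](scale0r w).
  apply: cvgD; first exact: cvg_cst.
  apply: cvgZr_tmp => //. apply: cvg_at_right_filter; exact: cvg_id.
exact: cvp.
Qed.

(** * Scalar product and quarter turn *)

Lemma dotpD n x y : dotp n (x + y) = dotp n x + dotp n y.
Proof. by rewrite /dotp /=; ring. Qed.

Lemma dotpZ n (t : R) x : dotp n (t *: x) = t * dotp n x.
Proof.
transitivity (n.1 * (t * x.1) + n.2 * (t * x.2)) => //.
by rewrite /dotp; ring.
Qed.

Lemma dotpZl n (t : R) x : dotp (t *: n) x = t * dotp n x.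
Proof.
transitivity (t * n.1 * x.1 + t * n.2 * x.2) => //.
by rewrite /dotp; ring.
Qed.

Lemma dotpN n x : dotp n (- x) = - dotp n x.
Proof. by rewrite /dotp /=; ring. Qed.

Lemma dotpB n x y : dotp n (x - y) = dotp n x - dotp n y.
Proof. by rewrite dotpD dotpN. Qed.

Lemma dotp_ge0 x : 0 <= dotp x x.
Proof. by rewrite /dotp; nra. Qed.

Lemma dotp_gt0 x : x != 0 -> 0 < dotp x x.
Proof.
move=> x0; rewrite lt_neqAle dotp_ge0 andbT eq_sym.
apply: contraNN x0; rewrite /dotp paddr_eq0 -?expr2 ?sqr_ge0//.
by rewrite !sqrf_eq0 => /andP[/eqP a /eqP b]; apply/eqP/plane_eq.
Qed.

Definition perp x : plane R := (- x.2, x.1).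

Lemma dotp_perp d : dotp (perp d) d = 0.
Proof. by rewrite /dotp /=; ring. Qed.

Lemma dotp_perpC d d' : dotp (perp d') d = - dotp (perp d) d'.
Proof. by rewrite /dotp /=; ring. Qed.

Lemma dotp_perp2 d d' : dotp (perp d) (perp d') = dotp d d'.
Proof. by rewrite /dotp /=; ring. Qed.

(** * The two sides of an edge *)

Lemma segm_dotp n x y z p : segm (x, y) z ->
  exists2 t : R, 0 <= t <= 1 &
    dotp n (z - p) = (1 - t) * dotp n (x - p) + t * dotp n (y - p).
Proof.
move=> [t t01 ->] /=; exists t => //.
by rewrite !dotpB !dotpD dotpZ !dotpB; ring.
Qed.

Lemma segm_on_line n (e : plane R * plane R) p z : dotp n (e.2 - e.1) = 0 ->
  segm e p -> segm e z -> dotp n (z - p) = 0.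
Proof.
move=> nd [s _ ->] [t _ ->].
by rewrite dotpB !dotpD !dotpZ nd; ring.
Qed.

Definition open_edge_point (e : plane R * plane R) p :=
  exists2 s : R, 0 < s < 1 & p = e.1 + s *: (e.2 - e.1).

(** A unit normal is required to point out of the cell only, so it must be
    shown that the opposite side of the edge is inside. Near p, the frontier
    reduces to the line of the edge, and there are points q of C since p is in
    the closure of C. If q were on the outer side or on the line, the segment
    from q to a point p + t n would stay off the frontier and force
    p + t n into C. So q is strictly on the inner side, from where every
    p - t n is reached. *)
Lemma interior_side {I : finType} (F : {set I}) (e : I -> plane R * plane R)
    C (l : I) p n :
  open C -> frontier C = [set x | exists2 k, k \in F & segm (e k) x] ->
  l \in F -> segm (e l) p ->
  (forall k, k \in F -> k != l -> ~ segm (e k) p) ->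
  n != 0 -> dotp n ((e l).2 - (e l).1) = 0 ->
  (\forall t \near (0:R)^'+, ~ closure C (p + t *: n)) ->
  \forall t \near (0:R)^'+, C (p - t *: n).
Proof.
move=> oC fC lF lp others n0 nd ext.
have /nbhs_ballP[r /= r0 avoid] : \forall x \near p,
    forall k, (k \in F) && (k != l) -> ~ segm (e k) x.
  by apply: near_avoid_segm => k /andP[kF kl]; exact: others.
have [q [Cq pq]] : C `&` ball p r !=set0.
  have : closure C p.
    suff : frontier C p by case.
    by rewrite fC; exists l.
  by apply; exact: nbhsx_ballx.
have nn : 0 < dotp n n by exact: dotp_gt0.
(* Points of C propagate along segments from q that leave q off the line of
   the edge: the frontier near p is on that line. *)
have reach y : ball p r y -> (forall z, segm (q, y) z -> C z \/ dotp n (z - p) != 0) -> C y.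
  move=> py off; apply: (segm_stays_inside _ _ _ oC Cq) => z qyz fz.
  case: (off z qyz) => [Cz|].
    by case: fz => _; rewrite (interior_id _).1.
  move: (fz); rewrite fC => -[k kF kz].
  have [kl|kl] := eqVneq k l.
    by rewrite kl in kz; rewrite (segm_on_line _ _ _ _ nd lp kz) eqxx.
  have := avoid z (ball_segm _ _ _ _ pq py z qyz) k.
  by rewrite kF kl => /(_ isT).
have nearb w : \forall t \near (0:R)^'+, ball p r (p + t *: w).
  exact: (near_ray _ _ w (nbhsx_ballx p r r0)).
have [q0|q0] := leP 0 (dotp n (q - p)).
- (* The case of q on the line is included: q itself is in C. *)
  have [t [[bt et] t0]] : exists t : R, (ball p r (p + t *: n) /\ ~ closure C (p + t *: n)) /\ 0 < t.
    apply: (@filter_ex _ (0:R)^'+); near=> t; split; first split.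
    + by near: t; exact: nearb.
    + by near: t.
    + by near: t; exact: nbhs_right_gt.
  exfalso; apply: et; apply: subset_closure; apply: reach => // z qz.
  case: (qz) => s; have [-> _ ->|s0 /andP[s00 s1] Ez] := eqVneq s 0.
    by left; rewrite scale0r addr0.
  right; rewrite Ez /= gt_eqF//.
  rewrite !dotpB dotpD dotpZ dotpB dotpD dotpZ.
  move: q0; rewrite dotpB; move: (dotp n q) (dotp n p) (dotp n n) nn => a b c c0 ab.
  have {}s0 : 0 < s by rewrite lt_neqAle eq_sym s0.
  have : 0 < s * (t * c) by rewrite !mulr_gt0.
  nra.
- near=> t.
  have t0 : 0 < t by near: t; exact: nbhs_right_gt.
  apply: reach.
    rewrite -scalerN; near: t; exact: nearb.
  move=> z /(segm_dotp n _ _ _ p)[s /andP[s0 s1] ->]; right.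
  rewrite lt_eqF// (addrC p) addrK dotpN dotpZ.
  have tc : 0 < t * dotp n n by rewrite mulr_gt0.
  have := convex_comb_gt0 s (- dotp n (q - p)) (t * dotp n n).
  by rewrite s0 s1 oppr_gt0 => /(_ isT q0 tc); lra.
Unshelve. all: by end_near. Qed.

(** * The sector at a vertex *)

Lemma near_pos_affine (a b : R) : 0 <= a -> (a = 0 -> 0 < b) ->
  \forall t \near (0:R)^'+, 0 < a + t * b.
Proof.
move=> a0 b0; have [a_0|a_0] := eqVneq a 0.
  near=> t; rewrite a_0 add0r mulr_gt0 ?b0//; near: t; exact: nbhs_right_gt.
have {}a0 : 0 < a by rewrite lt_neqAle eq_sym a_0.
have b1 : 0 < `|b| + 1 by rewrite ltr_wpDl.
near=> t.
have t0 : 0 < t by near: t; exact: nbhs_right_gt.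
have : t < a / (`|b| + 1) by near: t; apply: nbhs_right_lt; rewrite divr_gt0.
rewrite ltr_pdivlMr// => tb.
have := ler_norm (- b); rewrite normrN => nb.
have : 0 <= t * (`|b| + b) by apply: mulr_ge0; [exact: ltW|lra].
lra.
Unshelve. all: by end_near. Qed.

(** At a vertex v where edge k ends and edge l starts, c1 and c2 of the same
    sign select the same side of both edges (left if positive). When the curve
    does not turn away from that side, the sector on that side is convex near
    v, so that a point beside edge k and a point beside edge l are joined by a
    segment that meets no edge. One of the two sides of the curve always has a
    convex sector at v, and by [interior_side] what happens on one side of an
    edge determines what happens on the other. *)
Lemma corner {I : finType} (F : {set I}) (e : I -> plane R * plane R)
    C (k l : I) (c1 c2 : R) :
  let d1 := (e k).2 - (e k).1 in let d2 := (e l).2 - (e l).1 in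
  open C -> frontier C = [set x | exists2 k, k \in F & segm (e k) x] ->
  (e k).2 = (e l).1 ->
  (forall m, m \in F -> m != k -> m != l -> ~ segm (e m) (e l).1) ->
  d1 != 0 -> d2 != 0 ->
  (dotp (perp d1) d2 = 0 -> 0 < dotp d1 d2) ->
  0 < c1 * c2 -> 0 <= c1 * dotp (perp d1) d2 ->
  exists p q, [/\ open_edge_point (e k) p, open_edge_point (e l) q &
    \forall t \near (0:R)^'+,
      C (p + t *: (c1 *: perp d1)) <-> C (q + t *: (c2 *: perp d2))].
Proof.
move=> d1 d2 oC fC; set v := (e l).1 => kv others d1n0 d2n0 noback c12 turn.
have dk : (e k).2 - (e k).1 = d1 by [].
have dl : (e l).2 - (e l).1 = d2 by [].
clearbody d1 d2.
have c1n0 : c1 != 0 by apply: contraTneq c12 => ->; rewrite mul0r ltxx.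
have c2n0 : c2 != 0 by apply: contraTneq c12 => ->; rewrite mulr0 ltxx.
have turn2 : 0 <= c2 * dotp (perp d1) d2.
  have : 0 <= (c1 * c2) * (c1 * dotp (perp d1) d2) by rewrite mulr_ge0// ltW.
  rewrite (_ : _ * _ = c1 ^+ 2 * (c2 * dotp (perp d1) d2)); last by ring.
  by rewrite pmulr_rge0// exprn_even_gt0.
have /nbhs_ballP[r /= r0 avoid] : \forall x \near v,
    forall m, [&& m \in F, m != k & m != l] -> ~ segm (e m) x.
  by apply: near_avoid_segm => m /and3P[mF mk ml]; exact: others.
have near_v : nbhs v (ball v r) by exact: nbhsx_ballx.
have [s [[[vp vq] s0] s1]] : exists s : R, ((ball v r (v - s *: d1) /\ ball v r (v + s *: d2))
    /\ 0 < s) /\ s < 1.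
  apply: (@filter_ex _ (0:R)^'+); near=> s; split; first split; first split.
  - by rewrite -scalerN; near: s; exact: (near_ray _ _ (- d1) near_v).
  - by near: s; exact: (near_ray _ _ d2 near_v).
  - by near: s; exact: nbhs_right_gt.
  - by near: s; exact: nbhs_right_lt.
set p := v - s *: d1 in vp; set q := v + s *: d2 in vq.
exists p, q; split.
- exists (1 - s); first by lra.
  by rewrite dk scalerBl scale1r addrA (_ : (e k).1 + d1 = v)// -dk addrC subrK.
- by exists s; rewrite ?s0 ?dl.
have B1 : nbhs p (ball v r) by apply: open_nbhs_nbhs; split => //; exact: ball_open.
have B2 : nbhs q (ball v r) by apply: open_nbhs_nbhs; split => //; exact: ball_open.
(* For small t the term in s, due to the turn, dominates; when the edges are
   aligned it is zero, and the other one is positive. *)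
have K (c c' : R) : c * c' = c1 * c2 -> 0 <= c * dotp (perp d1) d2 -> c != 0 ->
    \forall t \near (0:R)^'+, 0 < s * (c * dotp (perp d1) d2) + t * (c * c' * dotp d1 d2).
  move=> cc tc c0; apply: near_pos_affine; first by rewrite mulr_ge0// ltW.
  move=> /eqP; rewrite !mulf_eq0 (negbTE c0) gt_eqF//= => /eqP/noback nb.
  by rewrite cc mulr_gt0.
near=> t.
have t0 : 0 < t by near: t; exact: nbhs_right_gt.
set A := p + _; set B := q + _.
have vA : ball v r A by rewrite /A; near: t; exact: (near_ray _ _ _ B1).
have vB : ball v r B by rewrite /B; near: t; exact: (near_ray _ _ _ B2).
have pos (c : R) d : c != 0 -> d != 0 -> 0 < t * (c ^+ 2 * dotp d d).
  by move=> c0 dn0; rewrite pmulr_rgt0// pmulr_rgt0 ?dotp_gt0// exprn_even_gt0.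
have K1 : 0 < s * (c1 * dotp (perp d1) d2) + t * (c1 * c2 * dotp d1 d2).
  by near: t; exact: K.
have K2 : 0 < s * (c2 * dotp (perp d1) d2) + t * (c2 * c1 * dotp d1 d2).
  by near: t; apply: K; rewrite // mulrC.
(* A and B lie strictly on the same side of each of the two lines, and
   so does the segment between them. *)
have A1 : 0 < dotp (c1 *: perp d1) (A - v).
  have -> : dotp (c1 *: perp d1) (A - v) = t * (c1 ^+ 2 * dotp d1 d1).
    by rewrite /A /p !(dotpD, dotpN, dotpZ, dotpZl) dotp_perp dotp_perp2; ring.
  exact: pos.
have B1' : 0 < dotp (c1 *: perp d1) (B - v).
  suff -> : dotp (c1 *: perp d1) (B - v) =
    s * (c1 * dotp (perp d1) d2) + t * (c1 * c2 * dotp d1 d2) by [].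
  by rewrite /B /q !(dotpD, dotpN, dotpZ, dotpZl) dotp_perp2; ring.
have A2 : 0 < dotp (c2 *: perp d2) (A - v).
  suff -> : dotp (c2 *: perp d2) (A - v) =
    s * (c2 * dotp (perp d1) d2) + t * (c2 * c1 * dotp d1 d2) by [].
  rewrite /A /p !(dotpD, dotpN, dotpZ, dotpZl) (dotp_perpC d1) dotp_perp2.
  by rewrite /dotp; ring.
have B2' : 0 < dotp (c2 *: perp d2) (B - v).
  have -> : dotp (c2 *: perp d2) (B - v) = t * (c2 ^+ 2 * dotp d2 d2).
    by rewrite /B /q !(dotpD, dotpN, dotpZ, dotpZl) dotp_perp dotp_perp2; ring.
  exact: pos.
have sep (w x y z : plane R) : segm (x, y) z ->
    0 < dotp w (x - v) -> 0 < dotp w (y - v) -> dotp w (z - v) != 0.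
  move=> /(segm_dotp w _ _ _ v)[b /andP[b0 b1] ->] x0 y0; rewrite gt_eqF//.
  by apply: convex_comb_gt0; rewrite ?b0.
have kv' : segm (e k) v by rewrite -kv; exact: segm_end.
have lv' : segm (e l) v by exact: segm_start.
have clear x y : ball v r x -> ball v r y ->
    0 < dotp (c1 *: perp d1) (x - v) -> 0 < dotp (c1 *: perp d1) (y - v) ->
    0 < dotp (c2 *: perp d2) (x - v) -> 0 < dotp (c2 *: perp d2) (y - v) ->
    segm (x, y) `<=` ~` frontier C.
  move=> vx vy x1 y1 x2 y2 z xyz; rewrite fC => -[m mF mz].
  have := avoid z (ball_segm _ _ _ _ vx vy z xyz) m.
  have [mk _|mk] := eqVneq m k.
    have := sep _ _ _ _ xyz x1 y1.
    rewrite (segm_on_line _ (e k)) ?eqxx//; last by rewrite -mk.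
    by rewrite ?(dk, dl) dotpZl dotp_perp mulr0.
  have [ml _|ml] := eqVneq m l.
    have := sep _ _ _ _ xyz x2 y2.
    rewrite (segm_on_line _ (e l)) ?eqxx//; last by rewrite -ml.
    by rewrite ?(dk, dl) dotpZl dotp_perp mulr0.
  by rewrite mF => /(_ isT).
by split=> [CA|CB]; [apply: (segm_stays_inside C A)|apply: (segm_stays_inside C B)] => //; exact: clear.
Unshelve. all: by end_near. Qed.

(** Two consecutive edges with opposite directions would overlap: the shorter
    one would have its far end on the longer one. *)
Lemma no_foldback (P Q S : plane R) : P != Q -> Q != S -> P != S ->
  segm (P, Q) `&` segm (Q, S) `<=` [set P; Q] `&` [set Q; S] ->
  dotp (perp (Q - P)) (S - Q) = 0 -> 0 < dotp (Q - P) (S - Q).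
Proof.
move=> PQ QS PS meet par; rewrite ltNge; apply/negP => back.
have d1 : Q - P != 0 by rewrite subr_eq0 eq_sym.
have d2 : S - Q != 0 by rewrite subr_eq0 eq_sym.
have := dotp_gt0 _ d1; have := dotp_gt0 _ d2.
set a := dotp (Q - P) (Q - P); set b := dotp (S - Q) (S - Q) => b0 a0.
set m := dotp (Q - P) (S - Q) in back.
have E1 : S - Q = (m / a) *: (Q - P).
  apply: (scalerI (lt0r_neq0 a0)); rewrite scalerA mulrC divfK ?lt0r_neq0//.
  move: par; rewrite /m /a /dotp /perp; case: (Q - P) (S - Q) => [x y] [x' y'] /= par.
  apply: plane_eq => /=.
  + change ((x * x + y * y) * x' = (x * x' + y * y') * x).
    by apply/eqP; rewrite -subr_eq0 -(mulr0 (- y)) -par; apply/eqP; ring.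
  + change ((x * x + y * y) * y' = (x * x' + y * y') * y).
    by apply/eqP; rewrite -subr_eq0 -(mulr0 x) -par; apply/eqP; ring.
have E2 : b = (m / a) * m.
  by rewrite {1}/b {1}E1 dotpZl.
have m0 : m != 0 by apply: contraTneq b0 => m0; rewrite E2 m0 mulr0 ltxx.
have {}back : m < 0 by rewrite lt_neqAle m0.
have [ab|ba] := lerP (- m) a.
- have : segm (P, Q) S /\ segm (Q, S) S.
    split; last exact: (segm_end (Q, S)).
    exists (1 + m / a) => /=.
      have : -1 <= m / a by rewrite ler_pdivlMr // mulN1r; lra.
      have : m / a <= 0 by rewrite ler_pdivrMr // mul0r ltW.
      lra.
    by rewrite scalerDl scale1r -E1 addrA [P + _]addrC subrK addrC subrK.
  move=> /meet[[] SP _]; first by rewrite SP eqxx in PS.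
  by rewrite SP eqxx in QS.
- have E3 : Q - P = (a / m) *: (S - Q).
    by rewrite E1 scalerA mulrC mulrA divfK ?lt0r_neq0// divff// scale1r.
  have : segm (P, Q) P /\ segm (Q, S) P.
    split; first exact: (segm_start (P, Q)).
    exists (- (a / m)) => /=.
      have nm : 0 < - m by lra.
      rewrite -mulrN -invrN ler_pdivrMr // mul1r (ltW ba) andbT.
      by apply: divr_ge0; exact: ltW.
    by rewrite scaleNr -E3 opprB addrC subrK.
  move=> /meet[_ [] SP]; first by rewrite SP eqxx in PQ.
  by rewrite SP eqxx in PS.
Qed.

(** * Consistency of the outward normals *)

Lemma perpD x y : perp (x + y) = perp x + perp y.
Proof. by apply: plane_eq => //=; rewrite opprD. Qed.

Lemma perp0 : perp (0 : plane R) = 0.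
Proof. by apply: plane_eq => //=; rewrite oppr0. Qed.

Lemma enorm1_dotp n : enorm n = 1 -> dotp n n = 1.
Proof. by move=> n1; rewrite -(sqr_sqrtr (dotp_ge0 n)) -/(enorm n) n1 expr1n. Qed.

Lemma sqr_dotp_perp n d : enorm n = 1 -> dotp n d = 0 ->
  dotp n (perp d) ^+ 2 = dotp d d.
Proof.
move=> /enorm1_dotp n1 nd.
have -> : dotp n (perp d) ^+ 2 = dotp n n * dotp d d - dotp n d ^+ 2.
  by rewrite /dotp /=; ring.
by rewrite n1 nd mul1r expr0n subr0.
Qed.

Lemma normal_along_perp n d : enorm n = 1 -> dotp n d = 0 ->
  dotp n (perp d) *: n = perp d.
Proof.
move=> /enorm1_dotp n1 nd.
apply: plane_eq.
- transitivity (dotp n (perp d) * n.1) => //.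
  have -> : dotp n (perp d) * n.1 = dotp n d * n.2 - dotp n n * d.2.
    by rewrite /dotp /=; ring.
  by rewrite nd n1 mul0r mul1r sub0r.
- transitivity (dotp n (perp d) * n.2) => //.
  have -> : dotp n (perp d) * n.2 = dotp n n * d.1 - dotp n d * n.1.
    by rewrite /dotp /=; ring.
  by rewrite nd n1 mul0r mul1r subr0.
Qed.

(** The length of an edge times its unit normal is its quarter turn, up to a
    sign that records on which side the normal points. *)
Lemma scaled_normal n d : enorm n = 1 -> dotp n d = 0 ->
  enorm d *: n = Num.sg (dotp n (perp d)) *: perp d.
Proof.
move=> n1 nd.
rewrite /enorm -(sqr_dotp_perp _ _ n1 nd) sqrtr_sqr.
by rewrite -{3}(normal_along_perp _ _ n1 nd) scalerA normrEsg.
Qed.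

(** If the outward normals of two consecutive edges were on different sides,
    then on the convex side of their common vertex [corner] would link a point
    just outside C with a point just inside C. *)
Lemma same_orientation {I : finType} (F : {set I}) (e : I -> plane R * plane R)
    C (k l : I) n1 n2 :
  let d1 := (e k).2 - (e k).1 in let d2 := (e l).2 - (e l).1 in
  open C -> frontier C = [set x | exists2 k, k \in F & segm (e k) x] ->
  k \in F -> l \in F -> (e k).2 = (e l).1 ->
  (forall m, m \in F -> m != k -> m != l -> ~ segm (e m) (e l).1) ->
  (forall p m, open_edge_point (e k) p -> m \in F -> m != k -> ~ segm (e m) p) ->
  (forall p m, open_edge_point (e l) p -> m \in F -> m != l -> ~ segm (e m) p) ->
  d1 != 0 -> d2 != 0 ->
  (dotp (perp d1) d2 = 0 -> 0 < dotp d1 d2) ->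
  outward_unit_normal C (e k) n1 -> outward_unit_normal C (e l) n2 ->
  Num.sg (dotp n1 (perp d1)) = Num.sg (dotp n2 (perp d2)).
Proof.
move=> d1 d2 oC fC kF lF kl others alone1 alone2 d1n0 d2n0 noback.
move=> [n1u n1d out1] [n2u n2d out2].
have edge_sub (m : I) p : open_edge_point (e m) p -> segm (e m) p.
  by move=> [s /andP[s0 s1] ->]; exists s; rewrite ?(ltW s0) ?(ltW s1).
have unit_n0 n : enorm n = 1 -> n != 0.
  move=> /enorm1_dotp; apply: contra_eq_neq => ->.
  by rewrite /dotp /= !mul0r addr0 eq_sym oner_eq0.
have ext1 p : open_edge_point (e k) p -> \forall t \near (0:R)^'+, ~ closure C (p + t *: n1).
  by move=> [s s01 ->]; exact: out1.
have ext2 p : open_edge_point (e l) p -> \forall t \near (0:R)^'+, ~ closure C (p + t *: n2).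
  by move=> [s s01 ->]; exact: out2.
have int1 p : open_edge_point (e k) p -> \forall t \near (0:R)^'+, C (p - t *: n1).
  move=> pk; apply: (interior_side F e C k) => //; first exact: edge_sub.
  - by move=> m; exact: alone1.
  - exact: unit_n0.
  - exact: ext1.
have int2 p : open_edge_point (e l) p -> \forall t \near (0:R)^'+, C (p - t *: n2).
  move=> pl; apply: (interior_side F e C l) => //; first exact: edge_sub.
  - by move=> m; exact: alone2.
  - exact: unit_n0.
  - exact: ext2.
have := normal_along_perp _ _ n1u n1d; have := normal_along_perp _ _ n2u n2d.
have := sqr_dotp_perp _ _ n1u n1d; have := sqr_dotp_perp _ _ n2u n2d.
rewrite -/d1 -/d2.
set o1 := dotp n1 _; set o2 := dotp n2 _ => o2d o1d n2E n1E.
have o1n0 : o1 != 0 by rewrite -sqrf_eq0 o1d gt_eqF// dotp_gt0.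
have o2n0 : o2 != 0 by rewrite -sqrf_eq0 o2d gt_eqF// dotp_gt0.
have {}n1E : n1 = o1^-1 *: perp d1 by rewrite -n1E scalerA mulVf// scale1r.
have {}n2E : n2 = o2^-1 *: perp d2 by rewrite -n2E scalerA mulVf// scale1r.
suff o12 : 0 < o1 * o2.
  have [pos1|neg1|o1_0] := ltgtP 0 o1; last by rewrite -o1_0 eqxx in o1n0.
    by rewrite !gtr0_sg//; rewrite pmulr_rgt0 in o12.
  by rewrite !ltr0_sg//; rewrite nmulr_rgt0 in o12.
rewrite ltNge le_eqVlt mulf_eq0 (negbTE o1n0) (negbTE o2n0) /=; apply/negP => o12.
have c12 : 0 < - (o1^-1 * o2^-1) by rewrite -invfM oppr_gt0 invr_lt0.
have [turn|turn] := leP 0 (o1^-1 * dotp (perp d1) d2).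
- (* convex on the outer side of k, taken to be the inner side of l *)
  rewrite -mulrN in c12.
  have [p [q [pk ql near_iff]]] :=
    corner F e C k l _ _ oC fC kl others d1n0 d2n0 noback c12 turn.
  have [t [[P Q] W]] : exists t : R,
      (~ closure C (p + t *: n1) /\ C (q - t *: n2)) /\
      (C (p + t *: (o1^-1 *: perp d1)) <-> C (q + t *: ((- o2^-1) *: perp d2))).
    apply: (@filter_ex _ (0:R)^'+); near=> t; split; last by near: t.
    by split; near: t; [exact: ext1|exact: int2].
  apply: P; apply: subset_closure; rewrite n1E; apply/W.
  by rewrite scaleNr -n2E scalerN.
- (* convex on the inner side of k, taken to be the outer side of l *)
  rewrite -mulNr in c12.
  have {}turn : 0 <= - o1^-1 * dotp (perp d1) d2 by rewrite mulNr oppr_ge0 ltW.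
  have [p [q [pk ql near_iff]]] :=
    corner F e C k l _ _ oC fC kl others d1n0 d2n0 noback c12 turn.
  have [t [[P Q] W]] : exists t : R,
      (~ closure C (q + t *: n2) /\ C (p - t *: n1)) /\
      (C (p + t *: ((- o1^-1) *: perp d1)) <-> C (q + t *: (o2^-1 *: perp d2))).
    apply: (@filter_ex _ (0:R)^'+); near=> t; split; last by near: t.
    by split; near: t; [exact: ext2|exact: int1].
  apply: P; apply: subset_closure; rewrite n2E; apply/W.
  by rewrite scaleNr -n1E scalerN.
Unshelve. all: by end_near. Qed.

(** * Sum of the scaled outward normals of a cell *)

Lemma next_next_neq {T : eqType} (s : seq T) (x : T) : uniq s -> (2 < size s)%N ->
  x \in s -> [/\ next s x != x & next s (next s x) != x].
Proof.
move=> us s2 /rot_to[i t E].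
rewrite -!(next_rot i us) E.
have := us; rewrite -(rot_uniq i) E; move: s2; rewrite -(size_rot i) E.
case: t {E} => [|y [|z t]]//= _; rewrite !inE !negb_or => /andP[/and3P[xy xz _] _].
by rewrite eqxx (eq_sym y x) (negbTE xy) eqxx eq_sym; split.
Qed.

Lemma telescope_path {T : eqType} (e : T -> plane R * plane R) (x : T) (s : seq T) :
  path (fun k l => (e k).2 == (e l).1) x s ->
  \sum_(k <- x :: s) ((e k).2 - (e k).1) = (e (last x s)).2 - (e x).1.
Proof.
elim: s x => [|y s IH] x /=; first by rewrite big_seq1.
move=> /andP[/eqP xy ps]; rewrite big_cons IH//= xy.
by rewrite addrC addrA subrK.
Qed.

(** The divergence theorem for constant fields on one cell. All the outward
    normals are on the same side of their edges, because consecutive ones are;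
    so the sum is, up to a sign, the quarter turn of the sum of the edge
    vectors, which vanishes on a closed curve. *)
Lemma cell_normals_sum0 {I : finType} (F : {set I}) (e : I -> plane R * plane R)
    C (n : I -> plane R) :
  polygonal_cell C F e ->
  (forall k, k \in F -> outward_unit_normal C (e k) (n k)) ->
  \sum_(k in F) enorm ((e k).2 - (e k).1) *: n k = 0.
Proof.
move=> [[s [us sF s2 cs [inj meet]]] oC _ _ fC] out.
have nF k : k \in F -> next s k \in F by rewrite -!sF mem_next.
have nE k : k \in F -> (e k).2 = (e (next s k)).1.
  by rewrite -sF => ks; apply/eqP; exact: (next_cycle cs).
have nn k : k \in F -> next s k != k /\ next s (next s k) != k.
  by rewrite -sF => ks; have [] := next_next_neq s k us s2 ks.
have e12 k : k \in F -> (e k).1 != (e k).2.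
  move=> kF; rewrite nE//; apply: contraNneq (proj1 (nn _ kF)) => E.
  by rewrite -(inj _ _ kF (nF _ kF) E).
have d0 k : k \in F -> (e k).2 - (e k).1 != 0 by move=> kF; rewrite subr_eq0 eq_sym e12.
have alone k : k \in F -> forall p m, open_edge_point (e k) p -> m \in F -> m != k ->
    ~ segm (e m) p.
  move=> kF p m [t /andP[t0 t1] pE] mF mk mp.
  have kp : segm (e k) p by exists t; rewrite ?(ltW t0) ?(ltW t1).
  have [_ []] := meet m k mF kF mk p (conj mp kp); rewrite pE.
  - move=> /eqP; rewrite -subr_eq0 addrAC subrr add0r scaler_eq0 (negbTE (d0 _ kF)).
    by rewrite gt_eqF.
  - move=> /eqP; rewrite -subr_eq0.
    have -> : (e k).1 + t *: ((e k).2 - (e k).1) - (e k).2 = (t - 1) *: ((e k).2 - (e k).1).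
      by rewrite scalerBl scale1r opprB addrCA addrA.
    by rewrite scaler_eq0 (negbTE (d0 _ kF)) subr_eq0 lt_eqF.
have others k : k \in F -> forall m, m \in F -> m != k -> m != next s k ->
    ~ segm (e m) (e (next s k)).1.
  move=> kF m mF mk ml mv; set v := (e (next s k)).1 in mv.
  have kv : segm (e k) v.
    by rewrite /v -nE//; exact: segm_end.
  (* v would be the start of m, so m is the edge after k, or the end of m, so
     m is k itself. *)
  have [[] vE _] := meet m k mF kF mk v (conj mv kv).
  - by move: ml; rewrite (inj _ _ mF (nF _ kF) (esym vE)) eqxx.
  - move: vE; rewrite /v nE// => /(inj _ _ (nF _ kF) (nF _ mF)) E.
    by move: mk; rewrite -(prev_next us m) -E prev_next// eqxx.
(* 1 if the outward normal is on the left of edge k, -1 if on the right *)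
pose o k := Num.sg (dotp (n k) (perp ((e k).2 - (e k).1))).
have o_next : cycle (fun k l => o k == o l) s.
  apply: cycle_from_next => // k; rewrite sF => kF; apply/eqP.
  have lF := nF _ kF.
  apply: (same_orientation F e C k (next s k)) => //.
  - exact: nE.
  - exact: others.
  - exact: alone.
  - exact: alone.
  - exact: d0.
  - exact: d0.
  - have := meet k (next s k) kF lF.
    rewrite eq_sym => /(_ (proj1 (nn _ kF))).
    have := e12 _ kF; have := e12 _ lF.
    have : (e k).1 != (e (next s k)).2.
      rewrite nE//; apply: contraNneq (proj2 (nn _ kF)) => E.
      by rewrite -(inj _ _ kF (nF _ lF) E).
    have := nE _ kF.
    case: (e k) (e (next s k)) => [P Q] [Q' S] /= <- PS QS PQ.
    exact: no_foldback.
  - exact: out.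
  - exact: out.
have -> : \sum_(k in F) enorm ((e k).2 - (e k).1) *: n k =
          \sum_(k <- s) o k *: perp ((e k).2 - (e k).1).
  rewrite big_uniq//; apply: eq_big => k; first by rewrite sF.
  by move=> kF; have [n1 nd _] := out k kF; exact: scaled_normal.
case: s us sF s2 cs nF nE nn others o_next => [//|x s] _ _ _ /= cs _ _ _ _ ox.
have const k : k \in x :: s -> o k = o x.
  rewrite inE => /predU1P[->//|ks].
  have : path (fun k l => o k == o l) x s by move: ox; rewrite rcons_path => /andP[].
  move=> /order_path_min => /(_ _)/allP P; apply/eqP; rewrite eq_sym; apply: P ks.
  by move=> a b c /eqP-> /eqP->.
transitivity (o x *: perp (\sum_(k <- x :: s) ((e k).2 - (e k).1))).
  rewrite (big_morph _ perpD perp0) scaler_sumr.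
  by apply: eq_big_seq => k ks; rewrite const.
move: cs; rewrite rcons_path => /andP[ps /eqP closed_s].
by rewrite telescope_path// closed_s subrr perp0 scaler0.
Qed.

End PolygonalCells.

(** * One time step from a lake at rest *)

Section LakeAtRest.
Context {R : realType} {N K : nat} (M : mesh R N K).
Context (g : R) (z : 'I_N -> R) (dt : R).
Context (a theta : cell_index N K -> cell_index N K -> R).
Context (h : 'I_N -> R) (u : 'I_N -> plane R) (H : R)
  (rest : forall j, h j + z j = H /\ u j = 0).

Lemma ext_cell (k : cell_index N K) :
  exists i, forall (T : Type) (f : 'I_N -> T), ext M f k = f i.
Proof. by case: k => i; [exists i|exists (ghost_copy M i)]. Qed.

(** The averaged height in the topography source is what makes the balance
    exact: (h_j + h_k) / 2 times h_j - h_k is the jump of h^2 / 2. *)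
Lemma hydrostatic_balance j k : ghdz M g z h j k = Pi g h j - ext M (Pi g h) k.
Proof.
rewrite /ghdz; have [i extE] := ext_cell k; rewrite !extE /Pi.
have [hj _] := rest j; have [hi _] := rest i.
have -> : z i - z j = h j - h i by lra.
by field.
Qed.

Lemma rest_u_face j k : u_face M g z a h u j k = 0.
Proof.
rewrite /u_face hydrostatic_balance; have [i extE] := ext_cell k; rewrite !extE.
rewrite (rest j).2 (rest i).2 addr0.
have -> : dotp (normal M j k) 0 = 0 by rewrite /dotp /= !mulr0 addr0.
by ring.
Qed.

(** The source term turns the face pressure into the pressure of the cell
    itself, which is the same on all the faces of the cell; the pressure force
    is then a multiple of the sum of the scaled outward normals. *)
Lemma rest_Pi_face j k : Pi_face M g z a theta h u j k = Pi g h j.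
Proof.
rewrite /Pi_face hydrostatic_balance; have [i extE] := ext_cell k; rewrite !extE.
rewrite (rest j).2 (rest i).2 subr0.
have -> : dotp (normal M j k) 0 = 0 by rewrite /dotp /= !mulr0 addr0.
by field.
Qed.

Lemma rest_tau_acoustic j : tau_acoustic M g z dt a h u j = tau h j.
Proof.
rewrite /tau_acoustic big1 ?mulr0 ?addr0// => k _.
by rewrite rest_u_face mulr0.
Qed.

Lemma rest_u_acoustic j : u_acoustic M g z dt a theta h u j = 0.
Proof.
rewrite /u_acoustic (rest j).2 sub0r.
rewrite (_ : \sum_(k in _) _ = 0) ?scaler0 ?oppr0//.
transitivity ((Pi g h j / area (cell M j)) *: \sum_(k in nbrs M j)
    enorm ((face M j k).2 - (face M j k).1) *: normal M j k).
  rewrite scaler_sumr; apply: eq_bigr => k _.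
  by rewrite rest_Pi_face scalerA /sigma; congr (_ *: _); ring.
rewrite (cell_normals_sum0 _ _ _ _ (cell_polygonal M j)) ?scaler0// => k.
exact: normal_outward.
Qed.

Lemma rest_transport {V : lmodType R} (phi : 'I_N -> V) j :
  transport M g z dt a h u phi j = phi j.
Proof.
rewrite /transport !big1 ?mulr0 ?scaler0 ?scale0r ?subr0 ?addr0// => k _.
  by rewrite rest_u_face mulr0.
by rewrite rest_u_face mulr0 scale0r.
Qed.

Lemma rest_h_next j : h_next M g z dt a h u j = h j.
Proof.
by rewrite /h_next rest_transport /h_acoustic rest_tau_acoustic /tau !div1r invrK.
Qed.

Lemma rest_u_next j : u_next M g z dt a theta h u j = 0.
Proof.
by rewrite /u_next /hu_next rest_transport /hu_acoustic rest_u_acoustic !scaler0.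
Qed.

End LakeAtRest.

Theorem proposition1 (R : realType) (N K : nat) (M : mesh R N K)
    (g : R) (g_gt0 : 0 < g) (z : 'I_N -> R) (dt : nat -> R)
    (a theta : nat -> cell_index N K -> cell_index N K -> R)
    (h : nat -> 'I_N -> R) (u : nat -> 'I_N -> plane R)
    (hu_sol : discrete_solution M g z dt a theta h u)
    (H : R)
    (init : forall j : 'I_N, h 0%N j + z j = H /\ u 0%N j = 0) :
  forall (n : nat) (j : 'I_N), h n j + z j = H /\ u n j = 0.
Proof.
elim=> [//|n rest] j; have [_ _ _ h_step u_step] := hu_sol n.
rewrite h_step u_step (rest_h_next _ _ _ _ _ _ _ _ rest).
by rewrite (rest_u_next _ _ _ _ _ _ _ _ _ rest); split; first exact: (rest j).1.
Qed.
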